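(* Let $S$ be a band of topological groups and for each $e\in E(S)$, let $\mathcal{U}_e$ be a base at $e$ in $S$. Then (1) for every $U\in\mathcal{U}_e$, there is an element $V\in\mathcal{U}_e$ such that $V^{-1}\subseteq U$; (2) for every $U\in\mathcal{U}_e$ and every $y\in U$, there is an element $V\in\mathcal{U}_{y^0}$ such that $(Vy)^*\subseteq U$; (3) for every $U\in\mathcal{U}_e$ and every $x,y\in S$ with $x^{-1}y\in U$, there exists $V\in\mathcal{U}_{y^0}$ such that $x^{-1}Vy\subseteq U$; (4) for every $a,b\in S$ and $W\in\mathcal{U}_{(ab)^0}$, there exist $U\in\mathcal{U}_{a^0}$ and $V\in\mathcal{U}_{b^0}$ such that $UaVb(ab)^{-1}\subseteq W$; (5) for $U,V\in\mathcal{U}_e$, there is $W\in\mathcal{U}_e$ such that $W\subseteq U\cap V$. Conversely, let $S$ be a cryptogroup and for each $e\in E(S)$, let $\mathcal{U}_e$ be a family of subsets of $S$ satisfying conditions (1)–(5). Let $\mathcal{U}=\bigcup_{e\in E(S)}\mathcal{U}_e$. Then the family $\mathcal{B}_{\mathcal{U}}=\{(Ua)^*: U\in\mathcal{U}\text{ and }a\in S\}$ is a base for some topology $\tau$ on $S$, and $(S,\tau)$ is a band of topological groups.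
   Context: A topological semigroup is a semigroup $S$ with a topology such that $(x,y)\mapsto xy$, $S\times S\to S$, is continuous. $E(S)$ is the set of idempotents of $S$; in conditions (1), (2), (3) and (5), $e$ denotes an arbitrary element of $E(S)$. A semigroup $S$ is completely regular if for each $a\in S$ there is $x\in S$ with $a=axa$ and $ax=xa$. In such a semigroup Green's relations are: $a\,\mathcal{L}\,b$ iff $Sa=Sb$; $a\,\mathcal{R}\,b$ iff $aS=bS$; $\mathcal{H}=\mathcal{L}\cap\mathcal{R}$. A cryptogroup is a completely regular semigroup in which $\mathcal{H}$ is a congruence. In a cryptogroup, each $\mathcal{H}$-class $H_x$ (the class containing $x$) is a group, $x^0$ is its identity, and $x^{-1}$ is the inverse of $x$ in the group $H_x$. A band is a semigroup in which every element is idempotent; a band congruence on $S$ is a congruence $\rho$ with $S/\rho$ a band. A topological semigroup $(S,\tau)$ is a band $B$ of topological groups $(G_\alpha,\tau_\alpha)$ $(\alpha\in B)$ if $S$ admits a band congruence $\rho$ such that $S/\rho=B$, each $G_\alpha$ (a topological group under the operation of $S$ and the topology $\tau_\alpha$) is the $\rho$-class mapped onto $\alpha$ by the natural epimorphism $S\to B$, and $\bigcup_{\alpha\in B}\tau_\alpha$ forms a base for $\tau$. ''Band of topological groups'' means a band $B$ of topological groups for some $B$ and some $(G_\alpha,\tau_\alpha)$; every such $S$ is a cryptogroup. A base at a point $x$ is a family of open sets containing $x$ such that every open set containing $x$ contains a member of the family. For subsets $U,V$ and elements $a,b,x,y$ of a cryptogroup $S$: $V^{-1}=\{v^{-1}:v\in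 V\}$, products such as $x^{-1}Vy$ and $UaVb(ab)^{-1}$ are elementwise product sets, and $(Ua)^*=\{x\in S: xa^{-1}\in U \text{ and } x^0=a^0\}$.
   Formalization: In the converse, each family U_e is additionally assumed to be nonempty with every member containing e; without this the converse fails (for example, all U_e empty satisfies (1)–(5), but B_U does not cover S). *)

(* Defs.v *)
From HB Require Import structures.
From Stdlib Require Import RelationClasses.
From mathcomp Require Import all_boot all_classical.
From mathcomp Require Import topology_structure product_topology.

Set Implicit Arguments.
Unset Strict Implicit.
Unset Printing Implicit Defensive.

Local Open Scope classical_set_scope.
Local Open Scope group_scope.

Section Semigroups.
Variable S : semigroupType.
Implicit Types (a b x y e : S) (A : set S) (rho : S -> S -> Prop).

Definition idempotents : set S := [set e | e * e = e].

Definition is_band : Prop := forall x, x * x = x.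

Definition completely_regular : Prop :=
  forall a, exists x, a = a * x * a /\ a * x = x * a.

(* Principal ideals are taken in S itself, without adjoining an identity;
   in a completely regular semigroup this makes no difference. *)
Definition greenL a b : Prop :=
  range (fun s : S => s * a) = range (fun s : S => s * b).

Definition greenR a b : Prop :=
  range (fun s : S => a * s) = range (fun s : S => b * s).

Definition greenH a b : Prop := greenL a b /\ greenR a b.

Definition congruence rho : Prop :=
  Equivalence rho /\
  forall a b c d, rho a b -> rho c d -> rho (a * c) (b * d).

Definition cryptogroup : Prop := completely_regular /\ congruence greenH.

(* [hone x] is $x^0$, the identity of the H-class of x, and [hinv x] is
   $x^{-1}$, the inverse of x in that H-class. Both are total functions with
   the junk value x; they have their meaning when the H-class is a group,
   which holds for every x in a completely regular semigroup. *)
Definition hone x : S :=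
  xget x [set e | greenH x e /\ forall y, greenH x y -> e * y = y /\ y * e = y].

Definition hinv x : S :=
  xget x [set y | [/\ greenH x y, x * y = hone x & y * x = hone x]].

(* $(Aa)^*$ *)
Definition star A a : set S :=
  [set x | A (x * hinv a) /\ hone x = hone a].

End Semigroups.

Arguments idempotents : clear implicits.
Arguments is_band : clear implicits.
Arguments completely_regular : clear implicits.
Arguments cryptogroup : clear implicits.

(* The natural epimorphism of S onto S / rho = B, with S / rho identified with
   B: a surjective morphism whose kernel is rho. *)
Definition is_quotient (S B : semigroupType) (rho : S -> S -> Prop)
    (pi : {multiplicative S -> B}) : Prop :=
  (forall a : B, exists x, pi x = a) /\ forall x y, rho x y <-> pi x = pi y.

(* Topologies are kept separate from the carrier, so that they can be
   quantified over on a fixed semigroup. [Topological T] also contains a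
   choice structure on T, which plays no role. *)
Definition topology (T : Type) := Topological T.

Definition space (T : Type) (tau : topology T) : topologicalType :=
  Topological.Pack tau.

Definition topological_semigroup (S : semigroupType) (tau : topology S) : Prop :=
  continuous (fun p : space tau * space tau => (p.1 : S) * p.2 : space tau).

(* The subset G of S is a group under the operation of S, and a topological
   group for the topology tau on G. *)
Definition topological_group (S : semigroupType) (G : set S)
    (tau : topology G) : Prop :=
  exists grp : Group G, let gT : groupType := Group.Pack grp in
  [/\ forall x y : gT, val (x * y : G) = val (x : G) * val (y : G) :> S,
      continuous (fun p : space tau * space tau => (p.1 : gT) * p.2 : space tau)
    & continuous (fun x : space tau => (x : gT)^-1 : space tau)].

Definition band_of_topological_groups (S : semigroupType) (tau : topology S) :
    Prop :=
  topological_semigroup tau /\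
  exists (rho : S -> S -> Prop) (B : semigroupType)
         (pi : {multiplicative S -> B})
         (tauG : forall a : B, topology (pi @^-1` [set a])),
  [/\ congruence rho, is_quotient rho pi, is_band B,
      forall a, topological_group (tauG a)
    & @basis (space tau)
        (\bigcup_a [set [set val x | x in O] | O in @open (space (tauG a))])].

Definition base_at (T : topologicalType) (x : T) (F : set (set T)) : Prop :=
  (forall A, F A -> open A /\ A x) /\
  forall O, open O -> O x -> exists2 A, F A & A `<=` O.

(* U_ is defined at every element of S, but only its values at idempotents
   matter: hone y, hone a, hone b and hone (a * b) are idempotents in a
   completely regular semigroup. *)
Section BaseConditions.
Variables (S : semigroupType) (U_ : S -> set (set S)).

Definition base_inv : Prop :=
  forall e, idempotents S e -> forall U, U_ e U ->
  exists2 V, U_ e V & [set hinv v | v in V] `<=` U.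

Definition base_star : Prop :=
  forall e, idempotents S e -> forall U, U_ e U -> forall y, U y ->
  exists2 V, U_ (hone y) V & star V y `<=` U.

Definition base_translate : Prop :=
  forall e, idempotents S e -> forall U, U_ e U ->
  forall x y, U (hinv x * y) ->
  exists2 V, U_ (hone y) V & [set hinv x * v * y | v in V] `<=` U.

Definition base_mul : Prop :=
  forall a b W, U_ (hone (a * b)) W ->
  exists U V, [/\ U_ (hone a) U, U_ (hone b) V
    & [set u * a * v * b * hinv (a * b) | u in U & v in V] `<=` W].

Definition base_cap : Prop :=
  forall e, idempotents S e -> forall U V, U_ e U -> U_ e V ->
  exists2 W, U_ e W & W `<=` U `&` V.

Definition base_conds : Prop :=
  [/\ base_inv, base_star, base_translate, base_mul & base_cap].

Definition star_base : set (set S) :=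
  [set A | exists U a, (\bigcup_(e in idempotents S) U_ e) U /\ A = star U a].

End BaseConditions.

(* Main.v *)
Require Import Defs.
From HB Require Import structures.
From mathcomp Require Import all_boot all_classical.
From mathcomp Require Import topology_structure initial_topology.
From mathcomp Require Import product_topology.

Set Implicit Arguments.
Unset Strict Implicit.
Unset Printing Implicit Defensive.

Local Open Scope classical_set_scope.
Local Open Scope group_scope.

(** Both directions go through one intrinsic description, the lemma
    [band_of_topological_groupsP]: a topology makes S a band of topological
    groups exactly when S is a cryptogroup, multiplication and
    $x \mapsto x^{-1}$ are continuous on S, and every H-class is open. Indeed,
    if S is a band B of groups, the classes of the band congruence are the
    H-classes: two elements of one group divide each other on both sides,
    while the band S / rho has trivial H, so that elements in different classes
    are not H-related. Thus S is a cryptogroup, and saying that the open sets of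
    the groups form a base of S means that each group is an open subspace.
    Conversely, in a cryptogroup the H-classes are groups, each meets
    E(S) in one element, so that S / H is E(S) with the product $(ef)^0$, and
    open H-classes with their subspace topologies form a base.

    With this description, conditions (1)-(5) for the bases at idempotents are
    the continuity of $x^{-1}$, of $v \mapsto vy$, of
    $v \mapsto x^{-1}vy$ and of $(u, v) \mapsto uavb(ab)^{-1}$ at the relevant
    idempotents, and the intersection property of neighbourhoods
    ([base_conds_topological_cryptogroup]).

    Conversely, given families with (1)-(5), call O open when each of its
    points x has some V in $\mathcal{U}_{x^0}$ with $(Vx)^* \subseteq O$.
    Condition (5) makes this a topology; condition (2) makes every $(Ua)^*$
    open ([open_star]), whence the sets $(Vx)^*$ with V in $\mathcal{U}_{x^0}$
    form a base at x ([star_nbhs]). Condition (4) then reads as the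
    continuity of multiplication and conditions (1) and (3) give that of
    $x^{-1}$; H-classes are open because $(Vx)^* \subseteq H_x$. *)

(** * Green's relation H in a completely regular semigroup *)

Section GreenH.
Context {S : semigroupType}.
Implicit Types a b e x y z : S.

Lemma greenH_sym x y : greenH x y -> greenH y x.
Proof. by case=> l r; split; apply: esym. Qed.

Lemma greenH_trans x y z : greenH x y -> greenH y z -> greenH x z.
Proof.
by move=> [l r] [l' r']; split; [apply: (etrans l)|apply: (etrans r)].
Qed.

(** Mutual divisibility on the left and on the right gives H: the equality of
    ideals needs only the inclusion of generators in each other's ideal. *)
Lemma greenH_dvd a b : (exists s, a = s * b) -> (exists s, b = s * a) ->
  (exists t, a = b * t) -> (exists t, b = a * t) -> greenH a b.
Proof.
move=> [s asb] [s' bsa] [t abt] [t' bat].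
split; rewrite /greenL /greenR eqEsubset; split.
- by move=> _ [u _ <-]; exists (u * s); rewrite // -mulgA -asb.
- by move=> _ [u _ <-]; exists (u * s'); rewrite // -mulgA -bsa.
- by move=> _ [u _ <-]; exists (t * u); rewrite // mulgA -abt.
- by move=> _ [u _ <-]; exists (t' * u); rewrite // mulgA -bat.
Qed.

End GreenH.

Section CompletelyRegular.
Context {S : semigroupType} (crS : completely_regular S).
Implicit Types a b e x y z : S.

(** For z with $x = xzx$ and $xz = zx$, the element $zxz$ is the inverse of x
    in the group with identity $xz$; z itself may lie outside the H-class
    of x. *)
Lemma completely_regular_inverse x : exists e y,
  [/\ e * x = x, x * e = x, x * y = e & y * x = e] /\
  greenH x e /\ greenH x y.
Proof.
have [z [xzx xz]] := crS x.
have ex : x * z * x = x by [].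
have xe : x * (x * z) = x by rewrite xz mulgA.
have xy : x * (z * x * z) = x * z by rewrite !mulgA ex.
have yx : z * x * z * x = x * z by rewrite -!mulgA (mulgA x) ex.
have ey : x * z * (z * x * z) = z * x * z.
  by rewrite xz -!mulgA (mulgA x) (mulgA (x * z)) ex.
have ye : z * x * z * (x * z) = z * x * z.
  by rewrite -!mulgA (mulgA x) (mulgA (x * z)) ex.
exists (x * z), (z * x * z); do 2!split=> //; apply: greenH_dvd.
- by exists x; rewrite xe.
- by exists z.
- by exists x.
- by exists z.
- by exists (x * x); rewrite -mulgA xy xe.
- by exists (z * x * z * (z * x * z)); rewrite -(mulgA (z * x * z)) yx ye.
- by exists (x * x); rewrite mulgA yx ex.
- by exists (z * x * z * (z * x * z)); rewrite mulgA xy ey.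
Qed.

(** The defining property of $x^0$ is realized: an idempotent e with
    $ex = x = xe$ acts as an identity on all of $xS \cap Sx$, which contains
    the H-class of x. *)
Lemma honeP x : greenH x (hone x) /\
  forall y, greenH x y -> hone x * y = y /\ y * hone x = y.
Proof.
apply: (@xgetPex _ x [set e | greenH x e /\ forall y, _ -> _]).
have [e [y [[ex xe _ _] [xHe _]]]] := completely_regular_inverse x.
exists e; split=> // z [Lxz Rxz].
have [f [w [[fz zf zw wz] _]]] := completely_regular_inverse z.
have [u _ xu] : range (fun s => x * s) z by rewrite Rxz; exists f.
have [v _ vx] : range (fun s => s * x) z by rewrite Lxz; exists f.
by split; [rewrite -xu mulgA ex | rewrite -vx -mulgA xe].
Qed.

Lemma greenH_hone x : greenH x (hone x).
Proof. by have [] := honeP x. Qed.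

Lemma hone_mul x : hone x * x = x.
Proof. by have [_ /(_ x)[]] := honeP x. Qed.

Lemma mul_hone x : x * hone x = x.
Proof. by have [_ /(_ x)[]] := honeP x. Qed.

(** Each H-class has one identity, so $x \mapsto x^0$ classifies H-classes.
    From here on H-classes are handled through $x^0$ alone. *)
Lemma greenH_honeE x y : greenH x y <-> hone x = hone y.
Proof.
split=> [xHy|xy].
  have [xx unitx] := honeP x; have [yy unity] := honeP y.
  have [<- _] := unitx _ (greenH_trans xHy yy).
  by have [_ ->] := unity _ (greenH_trans (greenH_sym xHy) xx).
apply: greenH_trans (greenH_hone x) _; rewrite xy.
by apply: greenH_sym; exact: greenH_hone.
Qed.

Lemma honeK x : hone (hone x) = hone x.
Proof. by apply/esym/greenH_honeE; exact: greenH_hone. Qed.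

Lemma hone_idem x : idempotents S (hone x).
Proof. by rewrite /idempotents /= -{1}(honeK x) hone_mul. Qed.

Lemma hinvP x :
  [/\ greenH x (hinv x), x * hinv x = hone x & hinv x * x = hone x].
Proof.
apply: (@xgetPex _ x [set y | [/\ greenH x y, x * y = _ & y * x = _]]).
have [e [y [[ex xe xy yx] [xHe xHy]]]] := completely_regular_inverse x.
suff <- : e = hone x by exists y.
have [_ /(_ e xHe)[he eh]] := honeP x.
have [u _ xu] : range (fun s => x * s) (hone x).
  have [_ ->] := greenH_hone x; exists (hone x) => //; exact: hone_idem.
by rewrite -eh -xu mulgA ex.
Qed.

Lemma mul_hinv x : x * hinv x = hone x.
Proof. by have [] := hinvP x. Qed.

Lemma hinv_mul x : hinv x * x = hone x.
Proof. by have [] := hinvP x. Qed.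

Lemma hone_hinv x : hone (hinv x) = hone x.
Proof. by apply/esym/greenH_honeE; have [] := hinvP x. Qed.

Lemma idem_hone e : idempotents S e -> hone e = e.
Proof.
by rewrite /idempotents /= => ee; rewrite -[RHS]mul_hone -mul_hinv mulgA ee.
Qed.

Lemma hinv_uniq x y : hone x = hone y -> x * y = hone x -> hinv x = y.
Proof.
move=> xy xy1; rewrite -(mul_hone (hinv x)) hone_hinv -xy1 mulgA hinv_mul.
by rewrite xy hone_mul.
Qed.

Lemma hinvK x : hinv (hinv x) = x.
Proof. by apply: hinv_uniq; rewrite hone_hinv ?hinv_mul. Qed.

Lemma hinv_idem e : idempotents S e -> hinv e = e.
Proof. by move=> ee; apply: hinv_uniq; rewrite // idem_hone. Qed.

End CompletelyRegular.

(** * H-classes of a cryptogroup *)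

Section Cryptogroup.
Context {S : semigroupType} (cgS : cryptogroup S).
Implicit Types a b e x y z : S.

Let crS : completely_regular S. Proof. by case: cgS. Qed.

Lemma honeM x x' y y' :
  hone x = hone x' -> hone y = hone y' -> hone (x * y) = hone (x' * y').
Proof.
have [_ [_ HM]] := cgS.
by move=> /(greenH_honeE crS) xx' /(greenH_honeE crS) yy';
  apply/(greenH_honeE crS)/HM.
Qed.

(** H-classes are subsemigroups: $xy$ is H-related to $x^0x^0 = x^0$. *)
Lemma hone_mul_same x y : hone x = hone y -> hone (x * y) = hone x.
Proof.
move=> xy; rewrite -[RHS](honeK crS) -(hone_idem crS x).
by apply: honeM; rewrite (honeK crS).
Qed.

End Cryptogroup.

(** * From a band of topological groups to continuity on S *)

Section BandOfGroups.
Context {S : semigroupType} (tau : topology S).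

Definition topological_cryptogroup : Prop :=
  [/\ cryptogroup S, topological_semigroup tau,
      continuous (@hinv S : space tau -> space tau)
    & forall a : S, @open (space tau) [set x | hone x = hone a]].

Lemma topological_group_unit (G : set S) (tG : topology G) :
  topological_group tG ->
  forall x, G x -> exists e z,
    [/\ G z, x * z = e, z * x = e & forall y, G y -> e * y = y /\ y * e = y].
Proof.
move=> [grp /= [valM _ _]] x Gx; pose gT := Group.Pack grp.
pose u : gT := SigSub (mem_set Gx) : G.
exists (val (1 : gT)), (val (u^-1 : gT)).
have ux : val (u : G) = x by [].
split.
- exact: set_valP.
- by rewrite -{1}ux -valM mulgV.
- by rewrite -{1}ux -valM mulVg.
- move=> y Gy; pose v : gT := SigSub (mem_set Gy) : G.
  have vy : val (v : G) = y by [].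
  by rewrite -vy -!valM mul1g mulg1.
Qed.

Section Quotient.
Variables (B : semigroupType) (pi : {multiplicative S -> B}).
Variable tauG : forall a : B, topology (pi @^-1` [set a]).
Hypotheses (bandB : is_band B) (tgG : forall a, topological_group (tauG a)).

Lemma class_val a (u : pi @^-1` [set a]) : pi (val u) = a.
Proof. exact: set_valP u. Qed.

(** If x and y are H-related, then their images in the band satisfy
    $\pi(x) = \pi(x)\pi(y)$ because $x \in Sy$, and $\pi(x)\pi(y) = \pi(y)$
    because $y \in xS$. Elements of one group divide each other. *)
Lemma greenH_kernel x y : greenH x y <-> pi x = pi y.
Proof.
split=> [xHy|xy].
  have [e [z [_ _ _ xe]]] := topological_group_unit (tgG (pi x)) (erefl (pi x)).
  have [f [w [_ _ _ yf]]] := topological_group_unit (tgG (pi y)) (erefl (pi y)).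
  have [[ex _] [_ yfy]] := (xe x erefl, yf y erefl).
  case: xHy; rewrite /greenL /greenR => L R.
  have [s _ sy] : range (fun s => s * y) x by rewrite -L; exists e.
  have [t _ xt] : range (fun s => x * s) y by rewrite R; exists f.
  have <- : pi x * pi y = pi x by rewrite -sy gmulfM -mulgA bandB.
  by rewrite -xt gmulfM mulgA bandB.
have [e [z [Gz xz zx xe]]] :=
  topological_group_unit (tgG (pi x)) (erefl (pi x)).
have [f [w [Gw yw wy yf]]] :=
  topological_group_unit (tgG (pi y)) (erefl (pi y)).
have [xf fx] := yf x xy; have [ey ye] := xe y (esym xy).
apply: greenH_dvd.
- by exists (x * w); rewrite -mulgA wy.
- by exists (y * z); rewrite -mulgA zx.
- by exists (w * x); rewrite mulgA yw.
- by exists (z * y); rewrite mulgA xz.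
Qed.

Lemma cryptogroup_of_quotient : cryptogroup S.
Proof.
split.
  move=> x.
  have [e [z [_ xz zx xe]]] :=
    topological_group_unit (tgG (pi x)) (erefl (pi x)).
  by exists z; rewrite xz zx; have [-> _] := xe x erefl.
split.
  split.
  - by move=> x; split.
  - by move=> x y; exact: greenH_sym.
  - by move=> x y z; exact: greenH_trans.
move=> x y z t /greenH_kernel xy /greenH_kernel zt.
by apply/greenH_kernel; rewrite !gmulfM xy zt.
Qed.

Let crS : completely_regular S := cryptogroup_of_quotient.1.

Lemma hone_kernel x y : hone x = hone y <-> pi x = pi y.
Proof. by rewrite -greenH_kernel (greenH_honeE crS). Qed.

Hypothesis mul_cont : topological_semigroup tau.
Hypothesis base : @basis (space tau)
  (\bigcup_a [set [set val x | x in O] | O in @open (space (tauG a))]).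

Lemma open_class_image a (O : set (pi @^-1` [set a])) :
  @open (space (tauG a)) O -> @open (space tau) (val @` O).
Proof. by move=> oO; apply: base.1; exists a => //; exists O. Qed.

(** Together with [open_class_image]: each class is an open subspace of S. A
    basic open set that meets the class of x comes from the group of x, since
    the classes are disjoint. *)
Lemma open_class_preimage a (O : set S) :
  @open (space tau) O -> @open (space (tauG a)) (val @^-1` O).
Proof.
move=> oO; rewrite openE => x Ox.
have : @nbhs _ (space tau) (val x) O by apply: open_nbhs_nbhs.
move=> /(base.2 (val x)) [_ [[b _ [P oP <-] [y Py yx]]] PO].
have ba : b = a by rewrite -(class_val y) -(class_val x) yx.
subst b; rewrite -(val_inj yx) /interior nbhsE; exists P => // z Pz.
by apply: PO; exists z.
Qed.

Lemma hinv_continuous_of_quotient :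
  continuous (@hinv S : space tau -> space tau).
Proof.
apply/continuousP => O oO; rewrite openE => x Ox; rewrite /interior nbhsE /=.
have [grp [valM _ inv_cont]] := tgG (pi x); pose gT := Group.Pack grp.
have hinv_val (u : gT) :
    val (u^-1 : pi @^-1` [set pi x]) = hinv (val (u : pi @^-1` [set pi x])).
  have hone_val (v w : gT) : hone (val (v : pi @^-1` [set pi x])) =
      hone (val (w : pi @^-1` [set pi x])).
    by apply/hone_kernel; rewrite !class_val.
  apply/esym/(hinv_uniq crS) => //.
  rewrite -valM mulgV.
  rewrite (hone_val u 1) (idem_hone crS) //.
  by rewrite /idempotents /= -valM mulg1.
have := (@continuousP (space (tauG (pi x))) (space (tauG (pi x)))
  (fun u : gT => u^-1)).1 inv_cont _ (open_class_preimage (pi x) oO).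
move=> /open_class_image oV.
exists (val @` ((fun u : gT => u^-1) @^-1` (val @^-1` O))).
  have Gx : (pi @^-1` [set pi x]) x by [].
  by split=> //; exists (SigSub (mem_set Gx)) => //=; rewrite hinv_val.
by move=> _ [u Ou <-] /=; rewrite -hinv_val.
Qed.

Lemma topological_cryptogroup_of_quotient : topological_cryptogroup.
Proof.
split.
- exact: cryptogroup_of_quotient.
- exact: mul_cont.
- exact: hinv_continuous_of_quotient.
- move=> a.
  have -> : [set x | hone x = hone a] = val @` [set: pi @^-1` [set pi a]].
    rewrite eqEsubset; split=> [x /hone_kernel xa|_ [x _ <-]] /=.
      have Gx : (pi @^-1` [set pi a]) x by [].
      by exists (SigSub (mem_set Gx)).
    by apply/hone_kernel; rewrite class_val.
  by apply: open_class_image; exact: openT.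
Qed.

End Quotient.

End BandOfGroups.

(** * A cryptogroup as a band of its H-classes *)

Section BandOfHClasses.
Context {S : semigroupType} (cgS : cryptogroup S).
Let crS : completely_regular S := cgS.1.

(** The band S / H, carried by the identities of the H-classes. A product of
    idempotents in S need not be idempotent; it is normalized to $(ef)^0$. *)
Definition band_of_idempotents : Type := idempotents S.
HB.instance Definition _ := Choice.on band_of_idempotents.

Definition idem_of (x : S) : band_of_idempotents :=
  SigSub (mem_set (hone_idem crS x)).

Lemma idem_of_eq x y : idem_of x = idem_of y <-> hone x = hone y.
Proof. by split=> [[]//|xy]; apply: val_inj. Qed.

Lemma idem_of_val (e : band_of_idempotents) : idem_of (val e) = e.
Proof. by apply: val_inj; rewrite /= (idem_hone crS) //; exact: set_valP. Qed.

Definition mul_idem (e f : band_of_idempotents) := idem_of (val e * val f).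

Lemma mul_idemA : associative mul_idem.
Proof.
move=> e f g; apply/idem_of_eq => /=.
transitivity (hone (val e * val f * val g)).
  by rewrite -mulgA; apply: (honeM cgS); rewrite ?(honeK crS).
by apply: (honeM cgS); rewrite ?(honeK crS).
Qed.

HB.instance Definition _ := isSemigroup.Build band_of_idempotents mul_idemA.

Lemma idem_ofM : {morph idem_of : x y / x * y}.
Proof.
by move=> x y; apply/idem_of_eq; apply: (honeM cgS); rewrite (honeK crS).
Qed.

HB.instance Definition _ :=
  isMultiplicative.Build S band_of_idempotents idem_of idem_ofM.

Section Class.
Variable e : band_of_idempotents.

Definition Hclass : Type := idem_of @^-1` [set e].
HB.instance Definition _ := Choice.on Hclass.

Lemma hone_Hclass (u : Hclass) : hone (val u) = val e.
Proof.
have ue : idem_of (val u) = e := set_valP u.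
exact: (congr1 (fun f : band_of_idempotents => val f) ue).
Qed.

Lemma Hclass_in x : hone x = val e -> x \in idem_of @^-1` [set e].
Proof. by move=> xe; apply/mem_set/val_inj. Qed.

Definition Hclass_mul (u v : Hclass) : Hclass.
refine (SigSub (Hclass_in (x := val u * val v) _)).
by rewrite (hone_mul_same cgS) !hone_Hclass.
Defined.

Definition Hclass_one : Hclass.
refine (SigSub (Hclass_in (x := val e) _)).
by rewrite (idem_hone crS) //; exact: set_valP.
Defined.

Definition Hclass_inv (u : Hclass) : Hclass.
refine (SigSub (Hclass_in (x := hinv (val u)) _)).
by rewrite (hone_hinv crS) hone_Hclass.
Defined.

Lemma Hclass_mulA : associative Hclass_mul.
Proof. by move=> u v w; apply: val_inj; rewrite /= mulgA. Qed.

Lemma Hclass_mul1g : left_id Hclass_one Hclass_mul.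
Proof.
by move=> u; apply: val_inj; rewrite /= -(hone_Hclass u) (hone_mul crS).
Qed.

Lemma Hclass_mulg1 : right_id Hclass_one Hclass_mul.
Proof.
by move=> u; apply: val_inj; rewrite /= -(hone_Hclass u) (mul_hone crS).
Qed.

Lemma Hclass_mulVg : left_inverse Hclass_one Hclass_inv Hclass_mul.
Proof.
by move=> u; apply: val_inj; rewrite /= (hinv_mul crS) hone_Hclass.
Qed.

Lemma Hclass_mulgV : right_inverse Hclass_one Hclass_inv Hclass_mul.
Proof.
by move=> u; apply: val_inj; rewrite /= (mul_hinv crS) hone_Hclass.
Qed.

HB.instance Definition _ := isGroup.Build Hclass
  Hclass_mulA Hclass_mul1g Hclass_mulg1 Hclass_mulVg Hclass_mulgV.

Definition Hclass_topology (tau : topology S) :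
    topology (idem_of @^-1` [set e]) :=
  Topological.class (initial_topology (fun u : Hclass => val u : space tau)).

Lemma Hclass_topology_open (tau : topology S) (O : set S) :
  @open (space tau) O ->
  @open (space (Hclass_topology tau)) [set u : Hclass | O (val u)].
Proof. by move=> oO; exists O. Qed.

Lemma Hclass_continuous (tau : topology S) (T : topologicalType)
    (f : T -> Hclass) :
  continuous (fun t => val (f t) : space tau) ->
  continuous (f : T -> space (Hclass_topology tau)).
Proof.
move=> /continuousP fc; apply/continuousP => _ [O oO <-].
exact: fc _ oO.
Qed.

(** The group operations of an H-class are restrictions of continuous
    operations of S, and the class has the initial topology of the
    inclusion. *)
Lemma topological_group_Hclass (tau : topology S) :
  topological_cryptogroup tau -> topological_group (Hclass_topology tau).
Proof.
move=> [_ mul_cont inv_cont _].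
have val_cont : continuous (fun u : space (Hclass_topology tau) =>
    val (u : Hclass) : space tau).
  exact: initial_continuous.
exists (Group.class Hclass); split.
- by [].
- apply: Hclass_continuous => p; set X := space _ in p *.
  have val1 : (fun q : X * X => val (q.1 : Hclass) : space tau) @ p -->
      (val (p.1 : Hclass) : space tau).
    apply: (@cvg_comp _ _ _ (fun q : X * X => q.1) _ _ (nbhs p.1)).
      exact: cvg_fst.
    exact: val_cont.
  have val2 : (fun q : X * X => val (q.2 : Hclass) : space tau) @ p -->
      (val (p.2 : Hclass) : space tau).
    apply: (@cvg_comp _ _ _ (fun q : X * X => q.2) _ _ (nbhs p.2)).
      exact: cvg_snd.
    exact: val_cont.
  have val12 : (fun q : X * X => (val (q.1 : Hclass) : space tau,
      val (q.2 : Hclass) : space tau)) @ p -->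
      (val (p.1 : Hclass) : space tau, val (p.2 : Hclass) : space tau).
    exact: cvg_pair.
  exact: (cvg_comp _ (fun r : space tau * space tau => (r.1 : S) * r.2) val12
    (mul_cont (val (p.1 : Hclass), val (p.2 : Hclass)))).
- apply: Hclass_continuous => u.
  exact: (cvg_comp _ (@hinv S : space tau -> space tau) (val_cont u)
    (inv_cont (val (u : Hclass)))).
Qed.

End Class.

Lemma band_of_topological_cryptogroup (tau : topology S) :
  topological_cryptogroup tau -> band_of_topological_groups tau.
Proof.
move=> tcS; have [_ mul_cont inv_cont openH] := tcS; split=> //.
exists (fun x y => hone x = hone y), band_of_idempotents, idem_of.
exists (fun e => Hclass_topology e tau); split.
- split; first by split=> // x y z -> .
  by move=> a b c d; exact: honeM.
- split=> [e|x y]; last by rewrite idem_of_eq.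
  by exists (val e); exact: idem_of_val.
- move=> e; rewrite -[RHS]idem_of_val; congr idem_of.
  by have : idempotents S (val e) by exact: set_valP.
- by move=> e; exact: topological_group_Hclass.
split.
  (* an open subset of the open subspace $H_e$ is open in S *)
  move=> _ [e _ [_ [O oO <-] <-]].
  have -> : [set val u | u in [set u : Hclass e | O (val u)]] =
      O `&` [set x | hone x = hone (val e)].
    have ee : hone (val e) = val e by apply: (idem_hone crS); exact: set_valP.
    rewrite eqEsubset ee; split=> [_ [u Ou <-]|x [Ox xe]] /=.
      by split=> //; exact: hone_Hclass.
    by exists (SigSub (Hclass_in xe)).
  exact: openI.
move=> x A xA.
have : @nbhs _ (space tau) x A by []; rewrite nbhsE => -[O [oO Ox] OA].
exists (val @` [set u : Hclass (idem_of x) | O (val u)]); last first.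
  by move=> _ [u Ou <-]; exact: OA.
split; last by exists (SigSub (@Hclass_in (idem_of x) x erefl)).
exists (idem_of x) => //; exists [set u : Hclass (idem_of x) | O (val u)] => //.
exact: Hclass_topology_open.
Qed.
End BandOfHClasses.

Lemma band_of_topological_groupsP (S : semigroupType) (tau : topology S) :
  band_of_topological_groups tau <-> topological_cryptogroup tau.
Proof.
split=> [[mul_cont [rho [B [pi [tauG [congH quo bandB tgG base]]]]]]|tcS].
  exact: topological_cryptogroup_of_quotient base.
by apply: band_of_topological_cryptogroup => //; case: tcS.
Qed.

(** * Bases at the idempotents satisfy the five conditions *)

Section BasesAtIdempotents.
Context {S : semigroupType} (tau : topology S) (U_ : S -> set (set S)).
Hypothesis tcS : topological_cryptogroup tau.
Hypothesis baseU : forall e : S, idempotents S e ->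
  @base_at (space tau) e (U_ e).

Let cgS : cryptogroup S. Proof. by case: tcS. Qed.
Let crS : completely_regular S := cgS.1.

Lemma base_at_nbhs e (A : set S) : idempotents S e -> @nbhs _ (space tau) e A ->
  exists2 V, U_ e V & V `<=` A.
Proof.
move=> /baseU [_ subV]; rewrite nbhsE => -[O [oO Oe] OA].
by have [V UV VO] := subV _ oO Oe; exists V => // x /VO /OA.
Qed.

Lemma base_at_open e A : idempotents S e -> U_ e A ->
  @open (space tau) A /\ A e.
Proof. by move=> /baseU [+ _] => /[apply]. Qed.

Lemma mul_nbhs a b (A : set S) : @nbhs _ (space tau) (a * b) A ->
  exists P Q : set S, [/\ @nbhs _ (space tau) a P, @nbhs _ (space tau) b Q &
    forall x y, P x -> Q y -> A (x * y)].
Proof.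
have [_ mul_cont _ _] := tcS.
move=> /(mul_cont (a, b)) [[P Q] [aP bQ] PQA].
by exists P, Q; split=> // x y Px Qy; exact: (PQA (x, y)).
Qed.

Lemma mulr_nbhs a b (A : set S) : @nbhs _ (space tau) (a * b) A ->
  @nbhs _ (space tau) a [set x | A (x * b)].
Proof.
move=> /mul_nbhs [P [Q [aP bQ PQA]]]; apply: filterS aP => x Px.
by apply: PQA => //; exact: nbhs_singleton bQ.
Qed.

Lemma mull_nbhs a b (A : set S) : @nbhs _ (space tau) (a * b) A ->
  @nbhs _ (space tau) b [set x | A (a * x)].
Proof.
move=> /mul_nbhs [P [Q [aP bQ PQA]]]; apply: filterS bQ => x Qx.
by apply: PQA => //; exact: nbhs_singleton aP.
Qed.

Lemma base_conds_topological_cryptogroup : base_conds U_.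
Proof.
have idem x : idempotents S (hone x) by exact: hone_idem.
split.
- move=> e ee U /(base_at_open ee) [oU Ue].
  have [_ _ inv_cont _] := tcS.
  have [|V UV VU] := @base_at_nbhs e (@hinv S @^-1` U) ee.
    by apply: inv_cont; rewrite (hinv_idem crS) //; exact: open_nbhs_nbhs.
  by exists V => // _ [v Vv <-]; exact: VU.
- move=> e ee U /(base_at_open ee) [oU Ue] y Uy.
  have [|V UV VU] := @base_at_nbhs (hone y) [set v | U (v * y)] (idem y).
    by apply: mulr_nbhs; rewrite (hone_mul crS); exact: open_nbhs_nbhs.
  exists V => // x [Vxy xy].
  by have := VU _ Vxy; rewrite /= -mulgA (hinv_mul crS) -xy (mul_hone crS).
- move=> e ee U /(base_at_open ee) [oU Ue] x y Uxy.
  have [|V UV VU] :=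
      @base_at_nbhs (hone y) [set v | U (hinv x * v * y)] (idem y).
    apply: (@mull_nbhs _ _ [set v | U (v * y)]); apply: mulr_nbhs.
    by rewrite -mulgA (hone_mul crS); exact: open_nbhs_nbhs.
  by exists V => // _ [v Vv <-]; exact: VU.
- move=> a b W /(base_at_open (idem _)) [oW We].
  (* $a^0ab^0b(ab)^{-1} = (ab)^0$, the value of the map at $(a^0, b^0)$ *)
  have : @nbhs _ (space tau) (hone a * (a * (hone b * b) * hinv (a * b))) W.
    rewrite (hone_mul crS) !mulgA (hone_mul crS) (mul_hinv crS).
    exact: open_nbhs_nbhs.
  rewrite !mulgA => /mulr_nbhs/mulr_nbhs/mul_nbhs [P [Q [aP bQ PQ]]].
  have [U UU UP] := base_at_nbhs (idem a) (mulr_nbhs aP).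
  have [V UV VQ] := base_at_nbhs (idem b) bQ.
  exists U, V; split=> // _ [u Uu [v Vv <-]].
  by apply: PQ; [exact: UP|exact: VQ].
- move=> e ee U V /(base_at_open ee) [oU Ue] /(base_at_open ee) [oV Ve].
  by apply: base_at_nbhs => //; apply: filterI; exact: open_nbhs_nbhs.
Qed.

End BasesAtIdempotents.

(** * The topology generated by the sets $(Ua)^*$ *)

Section TopologyFromStars.
Context {S : semigroupType} (U_ : S -> set (set S)).
Hypothesis cgS : cryptogroup S.
Hypothesis U_neq0 : forall e, idempotents S e -> U_ e !=set0.
Hypothesis U_self : forall e, idempotents S e ->
  forall U : set S, U_ e U -> U e.
Hypothesis condU : base_conds U_.

Let crS : completely_regular S := cgS.1.
Let idem x : idempotents S (hone x). Proof. exact: hone_idem. Qed.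

Definition star_open : set (set S) :=
  [set O | forall x, O x -> exists2 V, U_ (hone x) V & star V x `<=` O].

Lemma star_self V x : U_ (hone x) V -> star V x x.
Proof. by move=> /(U_self (idem x)) Vx; split=> //; rewrite (mul_hinv crS). Qed.

Lemma star_openT : star_open setT.
Proof. by move=> x _; have [V UV] := U_neq0 (idem x); exists V. Qed.

Lemma star_openI : setI_closed star_open.
Proof.
have [_ _ _ _ capU] := condU.
move=> O P oO oP x [/oO [V UV VO] /oP [W UW WP]].
have [X UX XVW] := capU _ (idem x) _ _ UV UW.
exists X => // y [/XVW [Vy Wy] yx].
by split; [exact: VO|exact: WP].
Qed.

Lemma star_open_bigU (I : Type) (f : I -> set S) :
  (forall i, star_open (f i)) -> star_open (\bigcup_i f i).
Proof.
move=> of_ x [i _ /of_ [V UV Vf]]; exists V => // y /Vf fy; by exists i.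
Qed.

Definition star_space : Type := S.
HB.instance Definition _ := Choice.on star_space.
HB.instance Definition _ :=
  isOpenTopological.Build star_space star_openT star_openI star_open_bigU.

Definition star_topology : topology S := Topological.class star_space.

Lemma star_topology_open O : @open (space star_topology) O = star_open O.
Proof. by []. Qed.

(** If $x \in (Ua)^*$, put $y = xa^{-1} \in U$ and take V in
    $\mathcal{U}_{y^0}$ with $(Vy)^* \subseteq U$. Here $y^0 = x^0$ and, for z
    in $H_x$, $(za^{-1})y^{-1} = zx^{-1}$, so that $z \in (Vx)^*$ implies
    $za^{-1} \in (Vy)^* \subseteq U$. *)
Lemma open_star e U a : idempotents S e -> U_ e U -> star_open (star U a).
Proof.
have [_ starU _ _ _] := condU.
move=> ee UU x [Uxa xa].
have hxa : hone (x * hinv a) = hone x.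
  by apply: (hone_mul_same cgS); rewrite (hone_hinv crS).
have [V] := starU _ ee _ UU _ Uxa; rewrite hxa => UV VU.
exists V => // z [Vzx zx]; split; last by rewrite zx.
apply: VU; split; last first.
  by rewrite hxa (hone_mul_same cgS) // (hone_hinv crS) zx.
have -> : hinv (x * hinv a) = a * hinv x.
  apply: (hinv_uniq crS).
    rewrite hxa (hone_mul_same cgS) ?(hone_hinv crS) ?xa //.
  rewrite mulgA -(mulgA x) (hinv_mul crS) -xa (mul_hone crS).
  by rewrite (mul_hinv crS) hxa.
by rewrite mulgA -(mulgA z) (hinv_mul crS) -xa -zx (mul_hone crS).
Qed.

Lemma star_nbhs x (A : set S) : @nbhs _ (space star_topology) x A <->
  exists2 V, U_ (hone x) V & star V x `<=` A.
Proof.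
rewrite nbhsE; split=> [[O [oO Ox] OA]|[V UV VA]].
  by have [V UV VO] := oO _ Ox; exists V => // y /VO /OA.
by exists (star V x) => //; split; [exact: open_star UV|exact: star_self].
Qed.

Lemma basis_star : @basis (space star_topology) (star_base U_).
Proof.
split=> [_ [U [a [[e ee UU] ->]]]|x A xA]; first exact: open_star UU.
have /star_nbhs [V UV VA] : @nbhs _ (space star_topology) x A by [].
exists (star V x) => //; split; last exact: star_self.
by exists V, x; split=> //; exists (hone x).
Qed.

(** For x in $(Ua)^*$ and y in $(Vb)^*$, the product $xy$ equals
    $(xa^{-1})a(yb^{-1})b$, so that $xy(ab)^{-1} \in UaVb(ab)^{-1}$. *)
Lemma topological_semigroup_star : topological_semigroup star_topology.
Proof.
have [_ _ _ mulU _] := condU.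
move=> [a b] A xA.
have /star_nbhs [W UW WA] : @nbhs _ (space star_topology) (a * b) A by [].
have [U [V [UU UV UVW]]] := mulU _ _ _ UW.
exists (star U a, star V b).
  by split; apply/star_nbhs; [exists U|exists V].
move=> [x y] [/= [Uxa xa] [Vyb yb]]; apply: WA; split; last exact: (honeM cgS).
apply: UVW; exists (x * hinv a) => //; exists (y * hinv b) => //.
by rewrite -(mulgA x) (hinv_mul crS) -xa (mul_hone crS) mulgA -(mulgA _ _ b)
  (hinv_mul crS) -yb -(mulgA x) (mul_hone crS).
Qed.

(** A neighbourhood $(Wx^{-1})^*$ of $x^{-1}$ contains $y^{-1}$, for y in $H_x$,
    when $y^{-1}x \in W$. As $x^{-1}x = x^0 \in W$, condition (3) gives V with
    $x^{-1}Vx \subseteq W$, and $y^{-1}x = x^{-1}(yx^{-1})^{-1}x$; so it is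
    enough that $yx^{-1}$ lies in a V' with $V'^{-1} \subseteq V$. *)
Lemma hinv_continuous_star :
  continuous (@hinv S : space star_topology -> space star_topology).
Proof.
have [invU _ transU _ _] := condU.
move=> x A xA.
have /star_nbhs [W + WA] : @nbhs _ (space star_topology) (hinv x) A by [].
rewrite (hone_hinv crS) => UW.
have [|V UV VW] := transU _ (idem x) _ UW x x.
  by rewrite (hinv_mul crS); exact: U_self UW.
have [V' UV' V'V] := invU _ (idem x) _ UV.
apply/star_nbhs; exists V' => // y [V'y yx]; apply: WA.
split; rewrite ?(hone_hinv crS) // (hinvK crS).
apply: VW; exists (x * hinv y).
  apply: V'V; exists (y * hinv x) => //.
  apply: (hinv_uniq crS).
    by rewrite !(hone_mul_same cgS) ?(hone_hinv crS) ?yx.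
  rewrite mulgA -(mulgA y) (hinv_mul crS) -yx (mul_hone crS) (mul_hinv crS).
  by rewrite (hone_mul_same cgS) // (hone_hinv crS).
by rewrite mulgA (hinv_mul crS) -yx -{1}(hone_hinv crS y) (hone_mul crS).
Qed.

Lemma topological_cryptogroup_star : topological_cryptogroup star_topology.
Proof.
split.
- exact: cgS.
- exact: topological_semigroup_star.
- exact: hinv_continuous_star.
- move=> a; rewrite star_topology_open => x xa.
  have [V UV] := U_neq0 (idem x); exists V => // y [_ yx].
  by rewrite /= yx.
Qed.

End TopologyFromStars.

Theorem theorem3p7 :
  (forall (S : semigroupType) (tau : topology S) (U_ : S -> set (set S)),
     band_of_topological_groups tau ->
     (forall e : S, idempotents S e -> @base_at (space tau) e (U_ e)) ->
     base_conds U_)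
  /\
  (forall (S : semigroupType) (U_ : S -> set (set S)),
     cryptogroup S ->
     (forall e : S, idempotents S e ->
        U_ e !=set0 /\ forall U : set S, U_ e U -> U e) ->
     base_conds U_ ->
     exists tau : topology S,
       @basis (space tau) (star_base U_) /\ band_of_topological_groups tau).
Proof.
split=> [S tau U_ /band_of_topological_groupsP tcS baseU|S U_ cgS U_pt condU].
  exact: base_conds_topological_cryptogroup tcS baseU.
have U_neq0 e ee := (U_pt e ee).1; have U_self e ee := (U_pt e ee).2.
exists (star_topology cgS U_neq0 condU); split.
  exact: basis_star.
by apply/band_of_topological_groupsP; exact: topological_cryptogroup_star.
Qed.
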